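(* Let $\alpha\in(0,1)$, $T>0$, and consider the fractional ordinary differential equation $D_t^\alpha w(t)=f(t,w(t))$ for $t\in[0,T]$. Suppose $u(t),v(t)$ are, respectively, a sub- and a supersolution of this equation, i.e. $$ D_t^\alpha u(t)\le f(t,u(t)),\qquad D_t^\alpha v(t)\ge f(t,v(t))\qquad\text{for } t\in[0,T], $$ that $|u(t)|\le M$ and $|v(t)|\le M$ for $t\in[0,T]$, and that $$ |f_\omega(t,\omega)|\le K\qquad\text{for } t\in[0,T],\ |\omega|\le M, $$ where $M,K$ are constants. If $u(0)\le v(0)$, then $u(t)\le v(t)$ for all $t\in[0,T]$.
   Context: $D_t^\alpha$, $\alpha\in(0,1)$, is the Liouville-Caputo fractional derivative $D_t^\alpha h(t)=\frac{\partial}{\partial t}\frac{1}{\Gamma(1-\alpha)}\int_0^t(t-s)^{-\alpha}[h(s)-h(0)]\,ds$, with $\Gamma$ the Gamma function. $f_\omega=\partial f/\partial\omega$ denotes the partial derivative of $f(t,\omega)$ in its second variable. The functions $u,v,f$ are real-valued.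
   Formalization: The functions u and v are additionally assumed continuous on [0,T]; without this the claim fails (f = 0, v = 0, u the indicator of a single point t0 > 0). *)

(* Defs.v *)
From HB Require Import structures.
From mathcomp Require Import all_boot all_order all_algebra.
From mathcomp Require Import all_classical all_reals all_analysis.

Set Implicit Arguments.
Unset Strict Implicit.
Unset Printing Implicit Defensive.

Import Order.TTheory GRing.Theory Num.Theory.
Import numFieldNormedType.Exports.

Local Open Scope classical_set_scope.
Local Open Scope ring_scope.

(* Meaningful for 0 < x. *)
Definition Gamma (R : realType) (x : R) : R :=
  \int[lebesgue_measure]_(s in `]0, +oo[) (s `^ (x - 1) * expR (- s)).

Definition diff_quot (R : realType) (g : R -> R) (t s : R) : R :=
  (g s - g t) / (s - t).

(* The derivative of g at t as a function on A: two-sided at interior points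
   of A, one-sided at the endpoints when A is a nondegenerate interval.
   [derive_within] is meaningful only under [derivable_within]. *)
Definition derivable_within (R : realType) (A : set R) (g : R -> R) (t : R)
    : Prop :=
  cvg (diff_quot g t s @[s --> within A t^']).

Definition derive_within (R : realType) (A : set R) (g : R -> R) (t : R) : R :=
  lim (diff_quot g t s @[s --> within A t^']).

(* The value of 0 `^ (- alpha) at s = t does not affect the integral. *)
Definition frac_integral (R : realType) (alpha : R) (h : R -> R) (t : R) : R :=
  (Gamma (1 - alpha))^-1 *
  \int[lebesgue_measure]_(s in `[0, t]) ((t - s) `^ (- alpha) * (h s - h 0)).

(* Only the values of h on [0, T] matter here, for t in [0, T]. *)
Definition caputo_derivable (R : realType) (alpha T : R) (h : R -> R) (t : R)
    : Prop :=
  derivable_within `[0, T] (frac_integral alpha h) t.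

Definition caputo (R : realType) (alpha T : R) (h : R -> R) (t : R) : R :=
  derive_within `[0, T] (frac_integral alpha h) t.

(* Continuity cannot be dropped: the Caputo derivative does not see changes of
   the function on a null subset of ]0, T]. *)
Definition caputo_regular (R : realType) (alpha T : R) (h : R -> R) : Prop :=
  {within `[0, T], continuous h} /\
  (forall t : R, 0 <= t <= T -> caputo_derivable alpha T h t).

Definition subsolution (R : realType) (alpha T : R) (f : R -> R -> R)
    (u : R -> R) : Prop :=
  caputo_regular alpha T u /\
  (forall t : R, 0 <= t <= T -> caputo alpha T u t <= f t (u t)).

Definition supersolution (R : realType) (alpha T : R) (f : R -> R -> R)
    (v : R -> R) : Prop :=
  caputo_regular alpha T v /\
  (forall t : R, 0 <= t <= T -> f t (v t) <= caputo alpha T v t).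

(* Main.v *)
(* Let w = u - v and suppose that w is positive somewhere. Let a be the infimum
   of {w > 0}, and let w attain its maximum over a short interval starting at a
   in a point b of ]a, a + tau[. Put k x = x^(-alpha). On [0, b] the function
   P = (w b) 1_[a, b] - w is nonnegative and vanishes at b, and near b the
   differential inequalities bound the growth rate of k * (w - w 0) by
   Gamma(1 - alpha) K (w b), whereas k * ((w b) 1_[a, b]) grows at a rate at least
   (w b) tau^(-alpha), which is larger when tau is small. As k * (- w 0) is
   nondecreasing, N = k * P grows at a definite linear rate on an interval
   [b - eta, b].

   This contradicts P(s) -> 0 as s -> b. As P is merely continuous, the single
   increment N b - N (b - h) is not enough: it is only known to be at most
   o(1) h^(1-alpha). Instead one combines the increments of N over J = eta / h
   consecutive steps of length h with weights c_j, chosen so that the combined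
   kernel is nonpositive outside [b - h, b]. The weights are the tails of the
   renewal sequence d attached to the log-convex sequence a_n = (n + 1)^(-alpha)
   (Kaluza); their sum is of order J^alpha, so that
   h (eta / h)^alpha <= C o(1) h^(1-alpha), which fails as h -> 0. *)

Require Import Defs.
From HB Require Import structures.
From mathcomp Require Import all_boot all_order all_algebra.
From mathcomp Require Import all_classical all_reals all_analysis measurable_realfun.
From mathcomp Require Import ring lra zify.

Import Order.TTheory GRing.Theory Num.Theory.
Import numFieldNormedType.Exports.

Local Open Scope classical_set_scope.
Local Open Scope ring_scope.

(** Young's inequality with exponents 1/(1 - alpha) and 1/alpha gives y^(1-alpha) x^alpha <= (1 -
    alpha) y + alpha x. Division by x^alpha yields the tangent bound, with y = 0 included. *)
Lemma powR_concave_tangent (R : realType) (alpha x y : R) :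
  0 < alpha < 1 -> 0 < x -> 0 <= y ->
  (1 - alpha) * x `^ (- alpha) * (x - y) <= x `^ (1 - alpha) - y `^ (1 - alpha).
Proof.
move=> /andP[a0 a1] x0 y0.
have a1' : 1 - alpha != 0 by rewrite subr_eq0 gt_eqF.
have := @conjugate_powR R (y `^ (1 - alpha)) (x `^ alpha) (1 - alpha)^-1 alpha^-1
  (powR_ge0 _ _) (powR_ge0 _ _).
rewrite !invr_gt0 subr_gt0 !invrK subrK -!powRrM => /(_ a1 a0 erefl).
rewrite mulfV// mulfV ?(gt_eqF a0)// !powRr1 ?(ltW x0)// => H.
have xa0 : 0 < x `^ alpha by exact: powR_gt0.
have E : x `^ (1 - alpha) = x / x `^ alpha.
  by rewrite powRB ?(gt_eqF x0) ?implybT// powRr1// ltW.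
rewrite E powRN -(ler_pM2r xa0).
have -> : ((1 - alpha) / x `^ alpha * (x - y)) * x `^ alpha = (1 - alpha) * (x - y).
  by field; rewrite gt_eqF.
rewrite [leRHS]mulrBl divfK ?gt_eqF//; lra.
Qed.

(** * Renewal sequences *)

Section renewal.
Variable R : realType.
Implicit Types (a d : nat -> R).

(* Kaluza's theorem: log-convexity keeps the solution [d] of the recursion
   nonnegative. *)
Lemma logconvex_renewal a J : a 0 = 1 -> (forall n, 0 < a n) ->
  (forall i m, (i <= m)%N -> a i.+1 * a m <= a m.+1 * a i) ->
  exists d, (forall j, 0 <= d j) /\
    forall m, (m < J)%N -> \sum_(j < m.+1) d j * a (m - j)%N = a m.+1.
Proof.
move=> a0 a_gt0 a_logconvex; elim: J => [|J [d [d_ge0 dE]]].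
  by exists (fun=> 0); split.
(* As a_0 = 1, the recursion at m = J forces the new value d_J; only its sign is at stake. *)
pose x := a J.+1 - \sum_(j < J) d j * a (J - j)%N.
have x_ge0 : 0 <= x.
  rewrite subr_ge0; case: J dE @x => [|J] dE _; first by rewrite big_ord0 ltW.
  (* After multiplication by a_(J+1), expanded on the right by the recursion at J, the claim holds
     term by term by log-convexity. *)
  rewrite -(ler_pM2r (a_gt0 J.+1)) -[X in _ <= _ * X](dE J)// mulr_suml mulr_sumr.
  apply: ler_sum => j _; rewrite -mulrA [leRHS]mulrCA ler_wpM2l//.
  have jJ := ltn_ord j; rewrite subSn//; apply: a_logconvex.
  by rewrite (leq_trans (leq_subr _ _)).
exists (fun j => if j == J then x else d j); split.
  by move=> j; case: ifP.
move=> m; rewrite ltnS leq_eqVlt => /predU1P[->|mJ].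
  rewrite big_ord_recr/= eqxx subnn a0 mulr1.
  rewrite (eq_bigr (fun j : 'I_J => d j * a (J - j)%N)); last first.
    by move=> j _; rewrite ltn_eqF.
  by rewrite /x; ring.
rewrite -dE//; apply: eq_bigr => j _; rewrite ltn_eqF//.
by rewrite (leq_trans (ltn_ord j)).
Qed.

(** In renewal terms [a n] is the probability of a renewal at time n, [d j] that of a waiting time j
    + 1, and this is the probability of a waiting time longer than m. *)
Definition renewal_tail d m : R := 1 - \sum_(j < m) d j.

Lemma renewal_tail0 d : renewal_tail d 0 = 1.
Proof. by rewrite /renewal_tail big_ord0 subr0. Qed.

Lemma renewal_tailS d m : renewal_tail d m.+1 = renewal_tail d m - d m.
Proof. by rewrite /renewal_tail big_ord_recr/= opprD addrA. Qed.

(** Decomposition at the last renewal up to time m: it happens at m - j when the waiting time that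
    follows exceeds j. *)
Lemma renewal_tail_conv a d J : a 0 = 1 ->
  (forall m, (m < J)%N -> \sum_(j < m.+1) d j * a (m - j)%N = a m.+1) ->
  forall m, (m <= J)%N -> \sum_(j < m.+1) renewal_tail d j * a (m - j)%N = 1.
Proof.
move=> a0 dE; elim=> [_|m IH mJ].
  by rewrite big_ord1 renewal_tail0 a0 mulr1.
rewrite big_ord_recl renewal_tail0 mul1r subn0.
rewrite (eq_bigr (fun j : 'I_m.+1 =>
  renewal_tail d j * a (m - j)%N - d j * a (m - j)%N)); last first.
  move=> j _; rewrite -mulrBl -renewal_tailS lift0 subSS//.
by rewrite sumrB IH ?(ltnW mJ)// dE//; ring.
Qed.

(** Monotonicity of [a] and the recursion give a_m (d_0 + ... + d_m) <= a_(m+1) <= a_m, so these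
    partial sums of [d] never exceed 1. *)
Lemma renewal_tail_ge0 a d J : (forall n, 0 < a n) ->
  (forall i m, (i <= m)%N -> a m <= a i) -> (forall j, 0 <= d j) ->
  (forall m, (m < J)%N -> \sum_(j < m.+1) d j * a (m - j)%N = a m.+1) ->
  forall m, (m <= J)%N -> 0 <= renewal_tail d m.
Proof.
move=> a_gt0 a_ni d_ge0 dE [|m] mJ.
  by rewrite renewal_tail0.
rewrite /renewal_tail subr_ge0 -(ler_pM2r (a_gt0 m)) mul1r mulr_suml.
apply: le_trans (_ : a m.+1 <= _); last exact: a_ni.
rewrite -dE//; apply: ler_sum => j _; apply: ler_wpM2l => //.
by apply: a_ni; rewrite leq_subr.
Qed.

(** Summing [renewal_tail_conv] over m <= J gives a sum of nonnegative terms over the triangle i + j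
    <= J; the product runs over the whole square. *)
Lemma renewal_tail_sum a d J : a 0 = 1 -> (forall n, 0 < a n) ->
  (forall i m, (i <= m)%N -> a m <= a i) -> (forall j, 0 <= d j) ->
  (forall m, (m < J)%N -> \sum_(j < m.+1) d j * a (m - j)%N = a m.+1) ->
  J.+1%:R <= (\sum_(j < J.+1) renewal_tail d j) * (\sum_(i < J.+1) a i).
Proof.
move=> a0 a_gt0 a_ni d_ge0 dE.
have c_ge0 := renewal_tail_ge0 a d J a_gt0 a_ni d_ge0 dE.
have cE := renewal_tail_conv a d J a0 dE.
have -> : J.+1%:R = \sum_(m < J.+1) \sum_(j < J.+1)
    (if (j <= m)%N then renewal_tail d j * a (m - j)%N else 0).
  rewrite (eq_bigr (fun=> 1)) ?sumr_const ?card_ord// => m _.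
  rewrite -big_mkcond/= -[RHS](cE m) -1?ltnS//.
  rewrite (big_ord_widen _ (fun j => renewal_tail d j * a (m - j)%N) (ltn_ord m)).
  by apply: eq_bigl => j.
rewrite exchange_big/= mulr_suml; apply: ler_sum => j _.
rewrite -big_mkcond/= -mulr_sumr ler_wpM2l ?c_ge0 -1?ltnS//.
rewrite -(big_mkord (fun m => (j <= m)%N) (fun m => a (m - j)%N)).
rewrite -(big_mkord xpredT a).
rewrite (big_cat_nat (n := j))//=; last exact: ltnW.
rewrite big_nat_cond big_pred0 ?add0r; last by move=> m; lia.
rewrite -[X in \sum_(X <= _ < _ | _) _]add0n big_addn.
rewrite [leRHS](big_cat_nat (n := J.+1 - j)) ?leq_subr//=.
rewrite -[leLHS]addr0; apply: lerD; last by apply: sumr_ge0 => i _; exact: ltW.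
rewrite big_mkcond/= le_eqVlt; apply/orP; left; apply/eqP; apply: eq_bigr => i _.
by rewrite leq_addl addnK.
Qed.

End renewal.

(** * The kernel of the fractional integral *)

Section kernel.
Variables (R : realType) (alpha : R).
Hypothesis alpha01 : 0 < alpha < 1.

Let alpha_gt0 : 0 < alpha. Proof. by case/andP: alpha01. Qed.
Let alpha_lt1 : alpha < 1. Proof. by case/andP: alpha01. Qed.

(** The cutoff lets the convolutions at all t <= b be taken over one interval [0, b], so that their
    increments combine under a single integral. *)
Definition abel_kernel (x : R) : R := if 0 < x then x `^ (- alpha) else 0.

Local Notation k := abel_kernel.

Lemma abel_kernel_ge0 x : 0 <= k x.
Proof. by rewrite /k; case: ifP => // _; exact: powR_ge0. Qed.

Lemma abel_kernel_le0 x : x <= 0 -> k x = 0.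
Proof. by move=> x0; rewrite /k ltNge x0. Qed.

Lemma abel_kernel_gt0 x : 0 < x -> k x = x `^ (- alpha).
Proof. by move=> x0; rewrite /k x0. Qed.

Lemma powRN_ni (x y : R) : 0 < x -> x <= y -> y `^ (- alpha) <= x `^ (- alpha).
Proof.
move=> x0 xy; have y0 := lt_le_trans x0 xy.
rewrite !powRN lef_pV2 ?posrE ?powR_gt0//.
by apply: ge0_ler_powR => //; rewrite ?nnegrE ltW.
Qed.

Lemma abel_kernel_ni x y : 0 < x -> x <= y -> k y <= k x.
Proof.
move=> x0 xy; rewrite !abel_kernel_gt0 ?powRN_ni//.
exact: lt_le_trans xy.
Qed.

Let a n : R := n.+1%:R `^ (- alpha).

Let a_gt0 n : 0 < a n. Proof. by rewrite powR_gt0. Qed.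

Let a0 : a 0 = 1. Proof. by rewrite /a powR1. Qed.

Let a_ni i m : (i <= m)%N -> a m <= a i.
Proof. by move=> im; apply: powRN_ni; rewrite ?ltr0n// ler_nat. Qed.

Let a_logconvex i m : (i <= m)%N -> a i.+1 * a m <= a m.+1 * a i.
Proof.
move=> im; rewrite /a -!powRM//; apply: powRN_ni; first by rewrite -natrM ltr0n.
rewrite -!natrM ler_nat; nia.
Qed.

(** The tangent bound at n + 1 dominates each [a n] by a difference of consecutive n^(1-alpha) / (1
    - alpha), and these telescope. *)
Let a_sum n : \sum_(i < n) a i <= n%:R `^ (1 - alpha) / (1 - alpha).
Proof.
rewrite ler_pdivlMr ?subr_gt0// mulrC; elim: n => [|n IH].
  by rewrite big_ord0 mulr0 powR_ge0.
rewrite big_ord_recr/= mulrDr.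
have := @powR_concave_tangent _ alpha n.+1%:R n%:R alpha01 (ltr0Sn _ _) (ler0n _ _).
rewrite -natr1 addrAC subrr add0r mulr1 natr1 -/(a n); lra.
Qed.

Lemma sum_by_parts (d q : nat -> R) J :
  \sum_(j < J.+1) renewal_tail R d j * (q j - q j.+1) =
  q 0 - (\sum_(j < J) d j * q j.+1 + renewal_tail R d J * q J.+1).
Proof.
elim: J => [|J IH].
  by rewrite big_ord1 big_ord0 renewal_tail0; ring.
rewrite big_ord_recr/= IH [in RHS]big_ord_recr/= !renewal_tailS; ring.
Qed.

(** Summation by parts turns the left side into k x minus an average of shifted values of k with
    nonnegative weights. For x > h this average has to dominate k x. On the grid (n + 1) h, where k
    is proportional to [a], this is the recursion; the cases below extend it to all x. *)
Lemma renewal_kernel_le (d : nat -> R) (J : nat) (h x : R) : 0 < h ->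
  (forall j, 0 <= d j) ->
  (forall m, (m < J)%N -> \sum_(j < m.+1) d j * a (m - j)%N = a m.+1) ->
  \sum_(j < J.+1) renewal_tail R d j * (k (x - j%:R * h) - k (x - j.+1%:R * h))
    <= if x <= h then k x else 0.
Proof.
move=> h0 d_ge0 dE.
rewrite (sum_by_parts d (fun j => k (x - j%:R * h))) mul0r subr0.
have c_ge0 := renewal_tail_ge0 R a d J a_gt0 a_ni d_ge0 dE J (leqnn J).
have S_ge0 n : 0 <= \sum_(j < n) d j * k (x - j.+1%:R * h).
  by apply: sumr_ge0 => j _; rewrite mulr_ge0// abel_kernel_ge0.
have [_|hx] := leP x h.
  by rewrite gerDl oppr_le0 addr_ge0// mulr_ge0// abel_kernel_ge0.
have x0 := lt_trans h0 hx.
rewrite subr_le0.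
have [Jx|xJ] := ltP (J.+1%:R * h) x.
  have kx j : (j < J.+1)%N -> k x <= k (x - j.+1%:R * h).
    move=> jJ; apply: abel_kernel_ni.
      by rewrite subr_gt0 (le_lt_trans _ Jx)// ler_pM2r// ler_nat.
    by rewrite gerBl mulr_ge0// ltW.
  (* Beyond the last node all shifts stay positive: the weights add up to 1 and every shifted value
     is at least k x. *)
  have -> : k x = \sum_(j < J) d j * k x + renewal_tail R d J * k x.
    by rewrite -mulr_suml /renewal_tail; ring.
  apply: lerD; last by rewrite ler_wpM2l// kx.
  by apply: ler_sum => j _; rewrite ler_wpM2l// kx// ltnS ltnW.
have [m mJ /andP[mx xm]] : exists2 m, (m < J)%N & m.+1%:R * h < x <= m.+2%:R * h.
  elim: J xJ {dE c_ge0} => [|J IH] xJ.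
    by move: xJ; rewrite mul1r leNgt hx.
  have [xJ'|Jx] := leP x (J.+1%:R * h).
    by have [m mJ H] := IH xJ'; exists m => //; exact: ltnW.
  by exists J => //; rewrite Jx.
rewrite -[leLHS]addr0 lerD//; last by rewrite mulr_ge0// abel_kernel_ge0.
(* The recursion at m distributes k x over the first m + 1 terms. Since x <= (m + 2) h, the shift by
   (j + 1) h multiplies x by at most (m + 1 - j) / (m + 2), hence k x by at least a_(m-j) /
   a_(m+1). *)
have kxa : k x = \sum_(j < m.+1) d j * (a (m - j)%N * (k x / a m.+1)).
  under eq_bigr do rewrite mulrA.
  by rewrite -mulr_suml dE// mulrC divfK// gt_eqF.
apply: (@le_trans _ _ (\sum_(j < m.+1) d j * k (x - j.+1%:R * h))); last first.
  rewrite -(big_mkord xpredT (fun j => d j * k (x - j.+1%:R * h))).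
  rewrite -(big_mkord xpredT (fun j => d j * k (x - j.+1%:R * h))).
  rewrite [leRHS](big_cat_nat (n := m.+1))//= lerDl.
  by apply: sumr_ge0 => j _; rewrite mulr_ge0// abel_kernel_ge0.
rewrite [leLHS]kxa; apply: ler_sum => j _; rewrite ler_wpM2l//.
have jm : (j <= m)%N by rewrite -ltnS.
have xj0 : 0 < x - j.+1%:R * h.
  by rewrite subr_gt0 (le_lt_trans _ mx)// ler_pM2r// ler_nat.
rewrite mulrA ler_pdivrMr// !abel_kernel_gt0// /a -!powRM ?(ltW x0) ?(ltW xj0)//.
apply: powRN_ni; first by rewrite mulr_gt0.
have -> : (m - j).+1%:R = m.+2%:R - j.+1%:R :> R.
  by rewrite -natrB ?ltnS ?leqW// subSS -subSn.
have jx : j.+1%:R * x <= j.+1%:R * (m.+2%:R * h) by rewrite ler_wpM2l.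
have -> : (x - j.+1%:R * h) * m.+2%:R = m.+2%:R * x - j.+1%:R * (m.+2%:R * h) by ring.
by rewrite mulrBl lerB.
Qed.

(** The weights are the renewal tails; the lower bound on their sum combines [renewal_tail_sum] with
    [a_sum]. *)
Lemma abel_kernel_weights (J : nat) (h : R) : 0 < h ->
  exists c : nat -> R,
  [/\ forall j, (j <= J)%N -> 0 <= c j,
      (1 - alpha) * J.+1%:R `^ alpha <= \sum_(j < J.+1) c j &
      forall x, \sum_(j < J.+1) c j * (k (x - j%:R * h) - k (x - j.+1%:R * h))
        <= if x <= h then k x else 0].
Proof.
move=> h0; have [d [d_ge0 dE]] := logconvex_renewal R a J a0 a_gt0 a_logconvex.
have c_ge0 := renewal_tail_ge0 R a d J a_gt0 a_ni d_ge0 dE.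
exists (renewal_tail R d); split => //; last by move=> x; exact: renewal_kernel_le.
have S0 : 0 <= \sum_(j < J.+1) renewal_tail R d j.
  by apply: sumr_ge0 => j _; apply: c_ge0; rewrite -ltnS.
have := renewal_tail_sum R a d J a0 a_gt0 a_ni d_ge0 dE.
move=> /le_trans/(_ (ler_wpM2l S0 (a_sum _))).
have n0 : 0 < J.+1%:R :> R by [].
have na0 : 0 < J.+1%:R `^ alpha :> R by exact: powR_gt0.
rewrite powRB ?(gt_eqF n0) ?implybT// powRr1// !mulrA ler_pdivlMr ?subr_gt0// ler_pdivlMr//.
by rewrite [leRHS]mulrC -mulrA ler_pM2l.
Qed.

End kernel.

(** * Integrals of the kernel *)

Section kernel_integral.
Variables (R : realType) (alpha : R).
Hypothesis alpha01 : 0 < alpha < 1.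
Local Notation mu := (@lebesgue_measure R).
Local Notation k := (abel_kernel R alpha).

Let alpha1_gt0 : 0 < 1 - alpha.
Proof. by case/andP: alpha01; rewrite subr_gt0. Qed.

Lemma measurable_abel_kernel : measurable_fun setT k.
Proof.
apply: measurable_fun_if => //.
- exact: measurable_fun_ltr.
- apply: measurable_funTS; exact: measurable_powR.
Qed.

Lemma measurable_abel_kernel_sub t (D : set R) : measurable D ->
  measurable_fun D (fun s => k (t - s)).
Proof.
move=> mD; apply: measurable_funTS.
apply: measurableT_comp; first exact: measurable_abel_kernel.
exact: measurable_funB.
Qed.

Let F t s : R := - ((1 - alpha)^-1 * (t - s) `^ (1 - alpha)).

Let dsub (t s : R) : is_derive s 1 (fun x : R => t - x) (-1).
Proof.
rewrite -[X in is_derive _ _ _ X]sub0r.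
exact: (is_deriveB (is_derive_cst t s 1) (is_derive_id s 1)).
Qed.

Let dF (t s : R) : s < t -> is_derive s 1 (F t) ((t - s) `^ (- alpha)).
Proof.
rewrite -subr_gt0 => ts0.
have d1 := @is_derive1_comp R (fun x => x `^ (1 - alpha)) (fun x => t - x)
  s _ _ (is_derive1_powR (1 - alpha) ts0) (dsub t s).
apply: (is_derive_eq (is_deriveN (is_deriveZ (1 - alpha)^-1 d1))).
rewrite (_ : 1 - alpha - 1 = - alpha); last by ring.
by rewrite /GRing.scale/=; field; exact: lt0r_neq0.
Qed.

(** Staying at distance e from the singularity s = t keeps the integrand continuous, so the
    fundamental theorem applies to the antiderivative [F t]. *)
Lemma abel_kernel_trunc_integral a t e : 0 < e -> a < t - e ->
  (\int[mu]_(s in `[a, (t - e)%R]) (k (t - s))%:E =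
   (((t - a) `^ (1 - alpha) - e `^ (1 - alpha)) / (1 - alpha))%:E)%E.
Proof.
move=> e0 ae.
have lt_t s : s \in `[a, t - e] -> s < t.
  by rewrite in_itv/= => /andP[_ /le_lt_trans]; apply; rewrite gtrBl.
transitivity (\int[mu]_(s in `[a, (t - e)%R]) ((t - s) `^ (- alpha))%:E)%E.
  by apply: eq_integral => s; rewrite inE/= => /lt_t st; rewrite abel_kernel_gt0// subr_gt0.
rewrite (@continuous_FTC2 R _ (F t))//; first last.
- move=> s sab; rewrite derive1E; apply: derive_val; apply: dF.
  by apply: lt_t; exact: subset_itv_oo_cc.
- have cF s : s \in `[a, t - e] -> F t x @[x --> s] --> F t s.
    by move=> /lt_t /dF H; apply/differentiable_continuous/derivable1_diffP; exact: ex_derive.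
  split.
  + by move=> s /subset_itv_oo_cc /lt_t /dF H; exact: ex_derive.
  + by apply/cvg_at_right_filter/cF; rewrite in_itv/= lexx ltW.
  + by apply/cvg_at_left_filter/cF; rewrite in_itv/= lexx ltW.
- apply: derivable_within_continuous => s /lt_t st.
  rewrite -subr_gt0 in st.
  have d1 := @is_derive1_comp R (fun x => x `^ (- alpha)) (fun x => t - x)
    s _ _ (is_derive1_powR (- alpha) st) (dsub t s).
  exact: ex_derive.
rewrite /F -EFinB; congr EFin.
rewrite (_ : t - (t - e) = e); last by ring.
by ring.
Qed.

Lemma abel_kernel_integral a t : a <= t ->
  (\int[mu]_(s in `[a, t]) (k (t - s))%:E =
   ((t - a) `^ (1 - alpha) / (1 - alpha))%:E)%E.
Proof.
rewrite le_eqVlt => /predU1P[->|ta].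
  by rewrite set_itv1 integral_set1 subrr powR0 ?mul0r// lt0r_neq0.
have ta0 : 0 < t - a by rewrite subr_gt0.
rewrite -integral_itv_bndo_bndc; last first.
  by apply/measurable_EFinP; exact: measurable_abel_kernel_sub.
(* The truncations exhaust [a, t[, and monotone convergence applies. The denominator n + 2 ensures a
   < t - e n already for n = 0. *)
pose e n : R := (t - a) / n.+2%:R.
pose A n : set R := `[a, (t - e n)%R]%classic.
have e_gt0 n : 0 < e n by rewrite divr_gt0.
have e_ni m n : (m <= n)%N -> e n <= e m.
  by move=> mn; rewrite ler_wpM2l ?(ltW ta0)// lef_pV2 ?posrE// ler_nat.
have e_cvg0 : e n @[n --> \oo] --> 0.
  rewrite -(mulr0 (t - a)); apply: cvgMl_tmp.
  have := @cvg_harmonic R; rewrite -(cvg_shiftS _ (nbhs 0)).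
  exact.
have -> : `[a, t[%classic = \bigcup_n A n.
  apply/seteqP; split => [s|s [n _]]; rewrite /A/= !in_itv/=; last first.
    by case/andP => -> /le_lt_trans -> //; rewrite gtrBl.
  case/andP => a_s st.
  have ts0 : 0 < t - s by rewrite subr_gt0.
  move/cvgrPdist_lt : e_cvg0 => /(_ _ ts0)[n _ /(_ n (leqnn n))].
  rewrite sub0r normrN gtr0_norm// => nts; exists n => //.
  by rewrite /A/= in_itv/=; lra.
have H : (\int[mu]_(s in A n) (k (t - s))%:E @[n --> \oo] -->
           \int[mu]_(s in \bigcup_n A n) (k (t - s))%:E)%E.
  apply: ge0_nondecreasing_set_cvg_integral => //.
  - move=> m n mn; rewrite subsetEset => s; rewrite /A/= !in_itv/= => /andP[-> /le_trans->]//.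
    by rewrite lerB// e_ni.
  - by move=> i; exact: measurable_itv.
  - move=> i; apply/measurable_EFinP; apply: measurable_abel_kernel_sub.
    exact: measurable_itv.
  - by move=> i x _; rewrite lee_fin abel_kernel_ge0.
apply: cvg_unique H _ => //.
rewrite (_ : (fun n => _) = EFin \o
  (fun n => (((t - a) `^ (1 - alpha) - e n `^ (1 - alpha)) / (1 - alpha)))); last first.
  apply/funext => n /=; rewrite abel_kernel_trunc_integral//.
  by rewrite ltrBrDr -ltrBrDl /e ltr_pdivrMr// ltr_pMr// ltr1n.
apply: cvg_EFin; first by near=> n.
apply: cvgMr_tmp; rewrite -[X in _ --> X]subr0; apply: cvgB; first exact: cvg_cst.
have /cvg_at_rightP := @powR_cvg0 R (1 - alpha) alpha1_gt0.
exact.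
Unshelve. all: by end_near.
Qed.

End kernel_integral.

(** * Convolution with the kernel *)

Section abel_convolution.
Variables (R : realType) (alpha : R).
Hypothesis alpha01 : 0 < alpha < 1.
Local Notation mu := (@lebesgue_measure R).
Local Notation k := (abel_kernel R alpha).

Implicit Types (a t b s : R) (g : R -> R).

Let alpha1_gt0 : 0 < 1 - alpha.
Proof. by case/andP: alpha01; rewrite subr_gt0. Qed.

Lemma Rintegral_abel_kernel_itv (g : R -> R) a t b : t <= b ->
  \int[mu]_(s in `[a, b]) (k (t - s) * g s) =
  \int[mu]_(s in `[a, t]) (k (t - s) * g s).
Proof.
move=> tb.
rewrite [RHS](_ : _ = \int[mu]_(s in `[a, b] `&` [set s | s <= t]) (k (t - s) * g s)).
  rewrite Rintegral_mkcondr; apply: eq_Rintegral => s _.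
  rewrite patchE; case: ifPn => //; rewrite notin_setE/= => /negP.
  by rewrite -ltNge => ts; rewrite abel_kernel_le0 ?mul0r// subr_le0 ltW.
congr Rintegral; apply/seteqP; split=> s/=; rewrite !in_itv/=.
  by case/andP => -> st; rewrite st (le_trans st tb).
by case=> /andP[-> _] ->.
Qed.

Lemma integrable_abel_kernel a t b : a <= t <= b ->
  mu.-integrable `[a, b] (EFin \o (fun s => k (t - s))).
Proof.
case/andP=> a_t tb.
apply/integrableP; split.
  by apply/measurable_EFinP; exact: measurable_abel_kernel_sub.
rewrite (_ : integral _ _ _ =
   \int[mu]_(s in `[a, b] `&` [set s | (s <= t)%R]) (k (t - s))%:E)%E; last first.
  rewrite integral_mkcondr; apply: eq_integral => s _.
  rewrite patchE/= ger0_norm ?abel_kernel_ge0//.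
  case: ifPn => //; rewrite notin_setE/= => /negP.
  by rewrite -ltNge => ts; rewrite abel_kernel_le0// subr_le0 ltW.
rewrite (_ : _ `&` _ = `[a, t]%classic) ?abel_kernel_integral ?ltry//.
apply/seteqP; split=> s/=; rewrite !in_itv/=.
  by case=> /andP[-> _] ->.
by case/andP => -> st; rewrite st (le_trans st tb).
Qed.

Lemma integrable_abel_kernelM (g : R -> R) (B : R) a t b : a <= t <= b ->
  measurable_fun `[a, b] g -> (forall s, a <= s <= b -> `|g s| <= B) ->
  mu.-integrable `[a, b] (EFin \o (fun s => k (t - s) * g s)).
Proof.
move=> atb mg gB.
have bg : [bounded g x | x in `[a, b]].
  exists B; split; first exact: num_real.
  by move=> M BM s /=; rewrite in_itv/= => /gB /le_trans; apply; exact: ltW.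
have := integrableMl _ (integrable_abel_kernel _ _ _ atb) mg bg.
exact.
Qed.

Definition abel_conv b g t : R := \int[mu]_(s in `[0, b]) (k (t - s) * g s).

(** The bound w is chosen before h: linear growth of the convolution up to b keeps P from tending to
    0 at b. *)
Lemma abel_conv_touch (P : R -> R) (b B eta delta : R) :
  0 < eta <= b -> 0 < delta ->
  measurable_fun `[0, b] P -> (forall s, 0 <= s <= b -> 0 <= P s <= B) ->
  (forall t t', b - eta <= t' -> t' <= t -> t <= b ->
     delta * (t - t') <= abel_conv b P t - abel_conv b P t') ->
  exists2 w, 0 < w & forall h, 0 < h <= eta ->
    exists2 s, b - h <= s <= b & w < P s.
Proof.
move=> /andP[eta0 eta_b] delta0 mP PB incr.
have a0 : 0 < alpha by case/andP: alpha01.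
(* If P <= w on [b - h, b], the bounds [low] and [up] below give delta h (1 - alpha) (J + 1)^alpha
   <= w h^(1-alpha) / (1 - alpha). With (J + 1) h = eta the powers of h cancel, leaving delta (1 -
   alpha)^2 eta^alpha <= w; half of that threshold is contradictory. *)
pose w := delta * (1 - alpha) ^+ 2 * eta `^ alpha / 2.
have w0 : 0 < w by rewrite divr_gt0// mulr_gt0 ?powR_gt0// mulr_gt0// exprn_gt0.
exists w => // h0 /andP[h0_gt0 h0_eta]; apply: contrapT => noP.
have Pw s : b - h0 <= s <= b -> P s <= w.
  by move=> sb; rewrite leNgt; apply/negP => wP; apply: noP; exists s.
(* The step has to divide eta exactly, so h0 is replaced by a smaller h = eta / (J + 1). *)
have [J hJ] : exists J, eta / J.+1%:R <= h0.
  have e_h : 0 <= eta / h0 by rewrite divr_ge0 ?ltW.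
  exists (Num.truncn (eta / h0)); rewrite ler_pdivrMr// -ler_pdivrMl// mulrC.
  by apply: ltW; rewrite truncnS_gt.
pose h := eta / J.+1%:R.
have h_gt0 : 0 < h by rewrite divr_gt0.
have Jh : J.+1%:R * h = eta by rewrite /h mulrC divfK.
have [c [c_ge0 c_sum c_k]] := abel_kernel_weights R alpha alpha01 J h h_gt0.
pose p j := b - j%:R * h.
have p_ge j : (j <= J.+1)%N -> b - eta <= p j.
  by move=> jJ; rewrite lerB// -Jh ler_pM2r// ler_nat.
have p_le j : p j <= b by rewrite gerBl mulr_ge0// ltW.
have p_step j : p j - p j.+1 = h by rewrite /p -natr1; ring.
have p_itv j : (j <= J.+1)%N -> 0 <= p j <= b.
  by move=> /p_ge H; rewrite p_le andbT (le_trans _ H)// subr_ge0.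
have P_norm s : 0 <= s <= b -> `|P s| <= B.
  by move=> /PB/andP[P0 ?]; rewrite ger0_norm.
have int_k j : (j <= J.+1)%N ->
    mu.-integrable `[0, b] (EFin \o (fun s => k (p j - s) * P s)).
  by move=> /p_itv H; exact: integrable_abel_kernelM P_norm.
(* The combined kernel; a general n allows the finite sum to be moved under the integral by
   induction, carrying integrability along. *)
pose G n s := \sum_(j < n) c j * (k (p j - s) - k (p j.+1 - s)).
have [int_G sumE] : mu.-integrable `[0, b] (EFin \o (fun s => G J.+1 s * P s)) /\
    \sum_(j < J.+1) c j * (abel_conv b P (p j) - abel_conv b P (p j.+1)) =
    \int[mu]_(s in `[0, b]) (G J.+1 s * P s).
  have: (J.+1 <= J.+1)%N by [].
  elim: {-2}(J.+1) => [_|n IH nJ].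
    rewrite /G; under [in X in integrable _ _ X]eq_fun do rewrite big_ord0 mul0r.
    split; first exact: integrable0.
    rewrite big_ord0; under eq_Rintegral do rewrite big_ord0 mul0r.
    by rewrite Rintegral_cst// mul0r.
  have [IH1 IH2] := IH (ltnW nJ).
  have GE : (fun s => G n.+1 s * P s) = (fun s =>
      G n s * P s + c n * (k (p n - s) * P s - k (p n.+1 - s) * P s)).
    by apply/funext => s; rewrite /G big_ord_recr/=; ring.
  have intB : mu.-integrable `[0, b]
      (EFin \o (fun s => k (p n - s) * P s - k (p n.+1 - s) * P s)).
    have := integrableB _ (int_k n (ltnW nJ)) (int_k n.+1 nJ).
    exact.
  have intZ : mu.-integrable `[0, b]
      (EFin \o (fun s => c n * (k (p n - s) * P s - k (p n.+1 - s) * P s))).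
    have := integrableZl _ (c n) intB.
    exact.
  rewrite GE; split.
    have := integrableD _ IH1 intZ.
    exact.
  rewrite big_ord_recr/= IH2 RintegralD//; congr (_ + _).
  by rewrite RintegralZl// RintegralB// ?int_k// ltnW.
have low : delta * h * ((1 - alpha) * J.+1%:R `^ alpha) <=
    \int[mu]_(s in `[0, b]) (G J.+1 s * P s).
  rewrite -sumE.
  apply: (@le_trans _ _ (delta * h * \sum_(j < J.+1) c j)).
    by rewrite ler_wpM2l// mulr_ge0 ?ltW.
  rewrite mulr_sumr; apply: ler_sum => j _.
  have jJ : (j <= J)%N by rewrite -ltnS.
  rewrite mulrC ler_wpM2l ?c_ge0//.
  rewrite -[X in _ * X](p_step j); apply: incr => //.
    exact: p_ge.
  by rewrite -subr_ge0 p_step ltW.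
have h_b : 0 <= b - h.
  by rewrite subr_ge0 (le_trans _ eta_b)// -Jh -[leLHS]mul1r ler_pM2r// ler1n.
have intk : mu.-integrable `[0, b] (EFin \o ((fun s => k (b - s)) \_ `[b - h, b])).
  rewrite -restrict_EFin; apply/integrable_restrict => //.
  apply: integrableS (integrable_abel_kernel 0 b b _) => //.
    exact: measurableI.
  by rewrite lexx (le_trans (ltW eta0)).
(* As P >= 0, the part of the combined kernel outside [b - h, b] contributes at most 0; inside, P <=
   w and the kernel is at most k (b - s). *)
have up : \int[mu]_(s in `[0, b]) (G J.+1 s * P s) <= w * (h `^ (1 - alpha) / (1 - alpha)).
  have -> : w * (h `^ (1 - alpha) / (1 - alpha)) =
      \int[mu]_(s in `[0, b]) (w * ((fun s => k (b - s)) \_ `[b - h, b]) s).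
    rewrite RintegralZl//; congr (_ * _).
    rewrite -Rintegral_mkcondr (_ : _ `&` _ = `[b - h, b]%classic).
      rewrite /Rintegral abel_kernel_integral//; last by rewrite gerBl ltW.
      by rewrite /= (_ : b - (b - h) = h)//; ring.
    apply/seteqP; split=> s/=; rewrite !in_itv/=; first by case.
    by move=> /andP[hs ->]; rewrite hs (le_trans h_b hs).
  apply: le_Rintegral => //.
    have := integrableZl _ w intk.
    exact.
  move=> s /=; rewrite in_itv/= => sb.
  have /andP[P0 _] := PB s sb.
  have Gk : G J.+1 s <= if b - s <= h then k (b - s) else 0.
    apply: le_trans (c_k (b - s)); rewrite le_eqVlt; apply/orP; left; apply/eqP.
    by apply: eq_bigr => j _; congr (_ * (k _ - k _)); rewrite /p; ring.
  apply: le_trans (ler_wpM2r P0 Gk) _.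
  rewrite patchE mem_setE in_itv/= (lerBlDr b s) -lerBlDl.
  case/andP: sb => s0 sb; rewrite sb andbT; case: ifPn => hs; last by rewrite mul0r mulr0.
  rewrite mulrC ler_wpM2r ?abel_kernel_ge0// Pw// sb andbT (le_trans _ hs)//.
  by rewrite lerB.
have := le_trans low up; apply/negP; rewrite -ltNge.
rewrite -ltr_pdivlMr ?divr_gt0 ?powR_gt0//.
rewrite (_ : _ / _ = delta * (1 - alpha) ^+ 2 * (J.+1%:R * h) `^ alpha).
  by rewrite Jh /w ltr_pdivrMr// ltr_pMr ?ltr1n// mulr_gt0 ?powR_gt0// mulr_gt0// exprn_gt0.
rewrite powRM ?(ltW h_gt0)// powRB ?(gt_eqF h_gt0) ?implybT// powRr1 ?ltW//.
by field; rewrite !gt_eqF ?powR_gt0//.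
Qed.

End abel_convolution.

(** The real-valued integral would be 0 if the integral were infinite, so finiteness is proved as
    well: the integrand is at most s^(x-1) on ]0, 1] and exp(-s) beyond. Positivity comes from the
    lower bound exp(-1) on ]0, 1]. *)
Lemma Gamma_gt0 (R : realType) (x : R) : 0 < x < 1 -> 0 < Gamma x.
Proof.
move=> /andP[x0 x1]; rewrite /Gamma /Rintegral.
pose f s : R := s `^ (x - 1) * expR (- s).
have f_ge0 s : 0 <= f s by rewrite mulr_ge0 ?powR_ge0 ?expR_ge0.
have mf : measurable_fun setT f.
  apply: measurable_funM; first exact: measurable_powR.
  by apply: measurableT_comp.
have mEf D : measurable D -> measurable_fun D (EFin \o f).
  by move=> mD; apply/measurable_EFinP; exact: measurable_funTS.
pose k := abel_kernel R (1 - x).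
pose g s : R := if s <= 1 then k s else 0.
have alpha01 : 0 < 1 - x < 1 by apply/andP; split; lra.
have mg : measurable_fun setT g.
  apply: measurable_fun_ifT => //; first exact: measurable_fun_ler.
  exact: measurable_abel_kernel.
have g_ge0 s : 0 <= g s by rewrite /g; case: ifP => // _; exact: abel_kernel_ge0.
have int_g : (\int[lebesgue_measure]_(s in `]0%R, +oo[) (g s)%:E < +oo)%E.
  apply: (@le_lt_trans _ _ (\int[lebesgue_measure]_(s in `[0%R, +oo[) (g s)%:E)%E).
    apply: ge0_subset_integral => //.
    - by apply/measurable_EFinP; exact: measurable_funTS.
    - by move=> s _; rewrite lee_fin.
    - by move=> s /=; rewrite !in_itv/= !andbT => /ltW.
  (* Reflecting s to -s turns this into the kernel integral over [-1, 0] with t = 0. *)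
  rewrite (@ge0_integration_by_substitution0 _ (EFin \o g)); last 2 first.
  - exact/measurable_EFinP.
  - by move=> s; rewrite lee_fin.
  rewrite (_ : integral _ _ _ =
     \int[lebesgue_measure]_(s in `]-oo, 0%R] `&` `[(-1)%R, 0%R]) (k (0 - s)%R)%:E)%E; last first.
    rewrite integral_mkcondr; apply: eq_integral => s; rewrite inE/= in_itv/= => s0.
    rewrite patchE/= mem_setE in_itv/= s0 andbT /g lerNl sub0r.
    by case: ifP.
  rewrite setIC setIidl; last by move=> s /=; rewrite !in_itv/= => /andP[].
  by rewrite abel_kernel_integral ?ltry// lerN10.
pose ex s : R := exponential_pdf 1 s.
have int_e : (\int[lebesgue_measure]_(s in `]0%R, +oo[) (ex s)%:E < +oo)%E.
  apply: (@le_lt_trans _ _ (\int[lebesgue_measure]_s (ex s)%:E)%E).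
    apply: ge0_subset_integral => //.
    - by apply/measurable_EFinP; exact: measurable_exponential_pdf.
    - by move=> s _; rewrite lee_fin exponential_pdf_ge0.
  by rewrite integral_exponential_pdf// ltry.
apply: fine_gt0; apply/andP; split.
  apply: (@lt_le_trans _ _ (\int[lebesgue_measure]_(s in `]0%R, 1%R]) (cst (expR (-1))%:E s))%E).
    rewrite integral_cst//= lebesgue_measure_itv/= lte01 oppr0 adde0 mule1.
    by rewrite lte_fin expR_gt0.
  apply: (@le_trans _ _ (\int[lebesgue_measure]_(s in `]0%R, 1%R]) (f s)%:E)%E).
    apply: ge0_le_integral => //.
    - by move=> s _; rewrite lee_fin expR_ge0.
    - exact: mEf.
    move=> s /=; rewrite in_itv/= => /andP[s0 s1].
    rewrite lee_fin /f -[leLHS]mul1r ler_pM ?expR_ge0 ?ler_expR ?lerN2//.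
    rewrite (_ : x - 1 = - (1 - x)); last by ring.
    by have := powRN_ni R _ alpha01 s 1 s0 s1; rewrite powR1.
  apply: ge0_subset_integral => //.
  - exact: mEf.
  - by move=> s _; rewrite lee_fin.
  - by move=> s /=; rewrite !in_itv/= andbT => /andP[].
apply: le_lt_trans (lte_add_pinfty int_g int_e).
rewrite -ge0_integralD//; last 4 first.
- by move=> s _; rewrite lee_fin.
- by apply/measurable_EFinP; exact: measurable_funTS.
- by move=> s _; rewrite lee_fin exponential_pdf_ge0.
- by apply/measurable_EFinP; apply: measurable_funTS; exact: measurable_exponential_pdf.
apply: ge0_le_integral => //.
- by move=> s _; rewrite lee_fin f_ge0.
- exact: mEf.
- by apply: emeasurable_funD; apply/measurable_EFinP; apply: measurable_funTS => //;
    exact: measurable_exponential_pdf.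
move=> s /=; rewrite in_itv/= andbT => s0.
rewrite -EFinD lee_fin /ex exponential_pdfE ?(ltW s0)// mul1r mulN1r /g /f.
rewrite (_ : x - 1 = - (1 - x)); last by ring.
case: ifPn => s1.
  rewrite /k abel_kernel_gt0// -[leLHS]addr0; apply: lerD; last exact: expR_ge0.
  by rewrite ler_piMr ?powR_ge0// -expR0 ler_expR oppr_le0 ltW.
rewrite add0r ler_piMl ?expR_ge0//.
have s1' : 1 <= s by rewrite ltW// ltNge.
by have := powRN_ni R _ alpha01 1 s ltr01 s1'; rewrite powR1.
Qed.

(** * Fractional integrals and the comparison principle *)

Section derive_within.
Variable R : realType.
Implicit Types (g l : R -> R) (a b T : R).

Lemma cvg_diff_quotP g (A : set R) (t l : R) :
  diff_quot g t s @[s --> within A t^'] --> l ->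
  forall e, 0 < e -> exists2 d, 0 < d & forall s, A s -> `|s - t| < d ->
    `|g s - g t - l * (s - t)| <= e * `|s - t|.
Proof.
move=> /cvgrPdist_le gl e e0.
have := gl e e0; rewrite near_withinE => /nbhs_ballP[d /= d0 dP].
exists d => // s As sd.
have [->|st] := eqVneq s t; first by rewrite !subrr mulr0 subr0 normr0 mulr0.
have st0 : s - t != 0 by rewrite subr_eq0.
have : `|l - diff_quot g t s| <= e.
  by apply: dP => //; rewrite /ball/= distrC.
have n0 : 0 < `|s - t| by rewrite normr_gt0.
by rewrite -(ler_pM2r n0) -normrM mulrBl /diff_quot divfK// distrC.
Qed.

(** The mean value theorem replaces integration of l, of which only a pointwise bound is known. The
    little-o hypothesis provides the derivative inside ]a, b[ and continuity up to the endpoints. *)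
Lemma le_increment g l a b C : a <= b ->
  (forall t e, a <= t <= b -> 0 < e -> exists2 d, 0 < d & forall s,
    a <= s <= b -> `|s - t| < d -> `|g s - g t - l t * (s - t)| <= e * `|s - t|) ->
  (forall t, a <= t <= b -> l t <= C) ->
  g b - g a <= C * (b - a).
Proof.
rewrite le_eqVlt => /predU1P[->|ab] gl lC; first by rewrite !subrr mulr0.
have [||c cab ->] := @MVT R g l a b ab.
- move=> x xab.
  have xab' : a <= x <= b by have := subset_itv_oo_cc xab.
  have gx : (fun h : R => h^-1 *: (g (h *: 1 + x) - g x)) @ 0^' --> l x.
    apply/cvgrPdist_le => e e0.
    have [d d0 dP] := gl x e xab' e0.
    move: xab; rewrite in_itv/= => /andP[ax xb].
    pose r := Num.min d (Num.min (x - a) (b - x)).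
    have r0 : 0 < r by rewrite !lt_min d0 !subr_gt0 ax xb.
    apply/nbhs_ballP; exists r => //= h; rewrite /ball/= sub0r normrN.
    rewrite !lt_min => /and3P[hd hxa hbx] h0.
    have /dP : a <= h + x <= b.
      by move: hxa hbx; rewrite !ltr_norml => /andP[? ?] /andP[? ?]; apply/andP; split; lra.
    rewrite addrK => /(_ hd) H.
    rewrite /GRing.scale/= mulr1 -(@ler_pM2r _ `|h|) ?normr_gt0//.
    rewrite -normrM mulrBl mulrAC mulVf// mul1r distrC.
    exact: H.
  apply: DeriveDef; first by apply/cvg_ex; exists (l x).
  exact: cvg_lim gx.
- apply/subspace_continuousP => x /=; rewrite in_itv/= => xab.
  apply/cvgrPdist_le => e e0.
  have [d d0 dP] := gl x 1 xab ltr01.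
  have lx0 : 0 < `|l x| + 1 by rewrite ltr_wpDl.
  apply/nbhs_ballP; exists (Num.min d (e / (`|l x| + 1))).
    by rewrite /= lt_min d0 divr_gt0.
  move=> s; rewrite /ball/= distrC lt_min => /andP[sd se]; rewrite in_itv/= => sab.
  have := dP s sab sd; rewrite mul1r => H.
  rewrite distrC (_ : g s - g x = (g s - g x - l x * (s - x)) + l x * (s - x)); last by ring.
  apply: le_trans (ler_normD _ _) _; rewrite normrM.
  apply: (@le_trans _ _ ((`|l x| + 1) * `|s - x|)).
    by rewrite mulrDl mul1r addrC lerD.
  by rewrite mulrC -ler_pdivlMr// ltW.
rewrite ler_wpM2r ?subr_ge0 ?(ltW ab)// lC//.
by have := subset_itv_oo_cc cab.
Qed.

Lemma within_continuous_dist g a b t e : {within `[a, b], continuous g} ->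
  a <= t <= b -> 0 < e ->
  exists2 d, 0 < d & forall s, a <= s <= b -> `|s - t| < d -> `|g s - g t| < e.
Proof.
move=> /subspace_continuousP cg tab e0.
have /cvgrPdist_lt/(_ e e0) : g @ within `[a, b] (nbhs t) --> g t.
  by apply: cg; rewrite /= in_itv.
rewrite near_withinE => /nbhs_ballP[d /= d0 dP]; exists d => // s sab st.
by rewrite distrC; apply: dP; rewrite /ball/= ?in_itv// distrC.
Qed.

End derive_within.

Section frac_integral.
Variables (R : realType) (alpha : R).
Hypothesis alpha01 : 0 < alpha < 1.

Lemma frac_integralE (h : R -> R) (t b : R) : t <= b ->
  frac_integral alpha h t =
  (Gamma (1 - alpha))^-1 * abel_conv R alpha b (fun s => h s - h 0) t.
Proof.
move=> tb; congr (_ * _).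
rewrite /abel_conv Rintegral_abel_kernel_itv//.
apply: eq_Rintegral => s; rewrite inE/= in_itv/= => /andP[_]; rewrite le_eqVlt.
case/predU1P => [->|st]; last by rewrite abel_kernel_gt0 ?subr_gt0.
(* By convention 0 to a nonzero power is 0, even a negative one, so both integrands vanish at s =
   t. *)
rewrite subrr powR0 ?abel_kernel_le0// oppr_eq0.
by case/andP: alpha01 => /gt_eqF ->.
Qed.

(** With a = 0 this is a constant on [0, b], so one computation serves both the jump at a and the
    constant - w 0 in P. *)
Definition step (a c : R) (s : R) : R := if a <= s then c else 0.

Lemma measurable_step a c : measurable_fun setT (step a c).
Proof. by apply: measurable_fun_ifT => //; exact: measurable_fun_ler. Qed.

Lemma step_bounded a c s : `|step a c s| <= `|c|.
Proof. by rewrite /step; case: ifP => // _; rewrite normr0. Qed.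

Lemma abel_conv_step (a b c t : R) : 0 <= a -> a <= t <= b ->
  abel_conv R alpha b (step a c) t = c * ((t - a) `^ (1 - alpha) / (1 - alpha)).
Proof.
move=> a0 /andP[a_t tb]; rewrite /abel_conv.
rewrite Rintegral_abel_kernel_itv//.
transitivity (\int[lebesgue_measure]_(s in `[0, t] `&` `[a, t])
    (c * abel_kernel R alpha (t - s))).
  rewrite Rintegral_mkcondr; apply: eq_Rintegral => s; rewrite inE/= in_itv/= => /andP[_ st].
  rewrite patchE mem_setE in_itv/= st andbT /step.
  by case: ifP => _; rewrite ?mulr0// mulrC.
rewrite setIidr; last first.
  by move=> s /=; rewrite !in_itv/= => /andP[/(le_trans a0) -> ->].
rewrite RintegralZl//; last by apply: integrable_abel_kernel; rewrite // a_t lexx.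
by rewrite /Rintegral abel_kernel_integral.
Qed.

End frac_integral.

Lemma derive1_le_increment (R : realType) (g : R -> R) (M K x y : R) :
  (forall w, `|w| <= M -> derivable g w 1) ->
  (forall w, `|w| <= M -> `|derive1 g w| <= K) ->
  `|x| <= M -> `|y| <= M -> x < y -> g y - g x <= K * (y - x).
Proof.
move=> dg gK xM yM xy.
have inM w : w \in `[x, y] -> `|w| <= M.
  move: xM yM; rewrite in_itv/= !ler_norml => /andP[? ?] /andP[? ?] /andP[? ?].
  by apply/andP; split; lra.
have [||c cxy ->] := @MVT R g (derive1 g) x y xy.
- move=> w wxy; rewrite derive1E; apply: derivableP; apply: dg.
  by apply: inM; exact: subset_itv_oo_cc wxy.
- by apply: derivable_within_continuous => w /inM /dg.
rewrite ler_wpM2r ?subr_ge0 ?(ltW xy)//; apply: le_trans (ler_norm _) _.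
by apply: gK; apply: inM; exact: subset_itv_oo_cc cxy.
Qed.

Lemma first_positive_max (R : realType) (w : R -> R) (T tau : R) : 0 < tau ->
  {within `[0, T], continuous w} -> w 0 <= 0 ->
  (exists2 t, 0 <= t <= T & 0 < w t) ->
  exists a b, [/\ (0 <= a) && (b <= T), a < b < a + tau, 0 < w b,
    forall s, 0 <= s <= a -> w s <= 0 & forall s, 0 <= s <= b -> w s <= w b].
Proof.
move=> tau0 cw w0 [t1 t1T wt1].
pose S := [set t | 0 <= t <= T /\ 0 < w t].
have hS : has_inf S.
  by split; [exists t1 | exists 0 => t [/andP[]]].
pose a := inf S.
have a0 : 0 <= a by apply: lb_le_inf; [exists t1 | move=> t [/andP[]]].
have aS t : S t -> a <= t by apply: ge_inf; case: hS.
have aT : a <= T by case/andP: (t1T) => _; apply: le_trans; exact: aS.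
have w_lt_a s : 0 <= s < a -> w s <= 0.
  move=> /andP[s0 sa]; rewrite leNgt; apply/negP => ws.
  have : a <= s by apply: aS; split => //; rewrite s0 (le_trans (ltW sa)).
  by rewrite leNgt sa.
have wa : w a <= 0.
  rewrite leNgt; apply/negP => wa_gt0.
  have a_gt0 : 0 < a.
    by rewrite lt_neqAle a0 andbT; apply/eqP => a0E; move: wa_gt0; rewrite -a0E ltNge w0.
  have aT' : 0 <= a <= T by rewrite a0.
  have [d d0 dP] := within_continuous_dist R w 0 T a (w a) cw aT' wa_gt0.
  (* If w a > 0, continuity would make w positive at this point to the left of a. *)
  pose s := Num.max 0 (a - d / 2).
  have s0 : 0 <= s by rewrite le_max lexx.
  have sa : s < a by rewrite gt_max a_gt0 gtrBl divr_gt0.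
  have ad_s : a - d / 2 <= s by rewrite le_max lexx orbT.
  have /dP : 0 <= s <= T by rewrite s0 (le_trans (ltW sa)).
  have sd : `|s - a| < d by rewrite ltr_norml; apply/andP; split; lra.
  move=> /(_ sd); rewrite ltr_norml => /andP[ws _].
  have := w_lt_a s; rewrite s0 sa => /(_ isT); lra.
have [t2 [/andP[t20 t2T] wt2] t2a] := inf_adherent tau0 hS.
have at2 : a <= t2 by apply: aS; split => //; rewrite t20.
have [|b] := @EVT_max R w a t2 at2.
  apply: continuous_subspaceW cw => s /=; rewrite !in_itv/= => /andP[as_ st].
  by rewrite (le_trans a0 as_) (le_trans st t2T).
rewrite in_itv/= => /andP[ab bt2] bmax.
have wb : 0 < w b by apply: lt_le_trans wt2 _; apply: bmax; rewrite in_itv/= at2 lexx.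
have ab' : a < b.
  by rewrite lt_neqAle ab andbT; apply/eqP => abE; move: wb; rewrite -abE ltNge wa.
have w_le_a s : 0 <= s <= a -> w s <= 0.
  by case/andP => s0; rewrite le_eqVlt => /predU1P[->//|sa]; apply: w_lt_a; rewrite s0.
exists a, b; split => //.
- by rewrite a0 (le_trans bt2).
- by rewrite ab' (le_lt_trans bt2).
- move=> s /andP[s0 sb]; have [sa|/ltW as_] := leP s a.
    by apply: le_trans (ltW wb); apply: w_le_a; rewrite s0.
  by apply: bmax; rewrite in_itv/= as_ (le_trans sb).
Qed.

Theorem theorem2p1 (R : realType) (alpha T M K : R)
    (f : R -> R -> R) (u v : R -> R)
    (alpha01 : 0 < alpha < 1) (T_gt0 : 0 < T)
    (u_sub : subsolution alpha T f u)
    (v_super : supersolution alpha T f v)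
    (u_le_M : forall t : R, 0 <= t <= T -> `|u t| <= M)
    (v_le_M : forall t : R, 0 <= t <= T -> `|v t| <= M)
    (f_derivable : forall t w : R,
       0 <= t <= T -> `|w| <= M -> derivable (f t) w 1)
    (f_omega_le_K : forall t w : R,
       0 <= t <= T -> `|w| <= M -> `|derive1 (f t) w| <= K)
    (uv0 : u 0 <= v 0) :
  forall t : R, 0 <= t <= T -> u t <= v t.
Proof.
case: u_sub => -[cu du] u_le; case: v_super => -[cv dv] v_ge.
move=> t1 t1T; rewrite leNgt; apply/negP => vu1.
pose w t := u t - v t.
have cw : {within `[0, T], continuous w} by move=> x; apply: cvgB; [exact: cu|exact: cv].
have w0 : w 0 <= 0 by rewrite subr_le0.
have T0 : 0 <= (0 : R) <= T by rewrite lexx (ltW T_gt0).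
have K0 : 0 <= K by apply: le_trans (f_omega_le_K 0 (u 0) T0 (u_le_M 0 T0)).
have alpha10 : 0 < 1 - alpha < 1 by case/andP: alpha01 => ? ?; apply/andP; split; lra.
have [alpha0 _] := andP alpha01; have [alpha1 _] := andP alpha10.
pose c := Gamma (1 - alpha).
have c0 : 0 < c by exact: Gamma_gt0.
have cK1 : 0 < c * K + 1 by rewrite ltr_wpDl// mulr_ge0// ltW.
(* Chosen so that tau^(-alpha) exceeds by 1 the rate c K allowed by the differential
   inequalities. *)
pose tau := (c * K + 1) `^ (- alpha^-1).
have tau0 : 0 < tau by exact: powR_gt0.
have tauE : tau `^ (- alpha) = c * K + 1.
  by rewrite -powRrM mulrNN mulVf ?gt_eqF// powRr1// ltW.
have w_gt0 : exists2 t, 0 <= t <= T & 0 < w t by exists t1 => //; rewrite subr_gt0.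
have [a [b [/andP[a0 bT] /andP[ab b_tau] wb w_le_a w_le_b]]] :=
  first_positive_max R w T tau tau0 cw w0 w_gt0.
have b0 : 0 < b := le_lt_trans a0 ab.
have bT' : 0 <= b <= T by rewrite ltW.
have [d d0 dP] := within_continuous_dist R w 0 T b (w b) cw bT' wb.
(* This keeps [b - eta, b] to the right of a and inside the region w > 0, where the bound on the
   derivative of f applies from v s up to u s. *)
pose eta := Num.min (d / 2) (b - a).
have eta0 : 0 < eta by rewrite lt_min divr_gt0// subr_gt0.
have eta_a : a <= b - eta by rewrite lerBrDl -lerBrDr ge_min lexx orbT.
have eta_b : 0 < eta <= b by rewrite eta0 -subr_ge0 (le_trans a0).
have w_pos s : b - eta <= s <= b -> 0 < w s.
  move=> /andP[es sb].
  have eta_d : eta <= d / 2 by rewrite ge_min lexx.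
  have s0T : 0 <= s <= T by rewrite (le_trans a0 (le_trans eta_a es)) (le_trans sb).
  have sd : `|s - b| < d by rewrite ltr_norml; apply/andP; split; lra.
  by have := dP s s0T sd; rewrite ltr_norml => /andP[+ _]; lra.
have [F FE] : exists F, F = frac_integral alpha by exists (frac_integral alpha).
have dF (y : R -> R) s : caputo_derivable alpha T y s ->
    diff_quot (F y) s r @[r --> within `[0, T] s^'] --> caputo alpha T y s.
  by rewrite FE.
(* The difference of the Caputo derivatives is at most f(s, u s) - f(s, v s) <= K w s <= K w b. *)
have incr t t' : b - eta <= t' -> t' <= t -> t <= b ->
    (F u t - F v t) - (F u t' - F v t') <= K * w b * (t - t').
  move=> et' t't tb.
  have inT s : t' <= s <= t -> 0 <= s <= T.
    move=> /andP[t's st]; rewrite (le_trans a0 (le_trans eta_a (le_trans et' t's))).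
    by rewrite (le_trans st (le_trans tb bT)).
  apply: (@le_increment _ (fun t => F u t - F v t)
    (fun s => caputo alpha T u s - caputo alpha T v s)) => //.
    move=> s e /inT sT e0; have e20 : 0 < e / 2 by rewrite divr_gt0.
    have [du0 du0_gt0 duP] := cvg_diff_quotP R _ _ _ _ (dF u s (du s sT)) _ e20.
    have [dv0 dv0_gt0 dvP] := cvg_diff_quotP R _ _ _ _ (dF v s (dv s sT)) _ e20.
    exists (Num.min du0 dv0); first by rewrite lt_min du0_gt0.
    move=> r /inT rT; rewrite lt_min => /andP[ru rv].
    have rT' : `[0, T]%classic r by rewrite /= in_itv.
    have := lerD (duP r rT' ru) (dvP r rT' rv); rewrite -mulrDl -splitr.
    apply: le_trans; apply: le_trans (ler_normB _ _).
    rewrite le_eqVlt; apply/orP; left; apply/eqP; congr `| _ |.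
    move: (F u r) (F v r) (F u s) (F v s) (caputo alpha T u s) (caputo alpha T v s).
    by clear=> *; ring.
  move=> s t'st; have sT := inT s t'st.
  have sb : b - eta <= s <= b.
    by case/andP: t'st => ? ?; rewrite (le_trans et')// (le_trans _ tb).
  have := w_pos s sb; rewrite subr_gt0 => vus.
  apply: le_trans (lerB (u_le s sT) (v_ge s sT)) _.
  apply: le_trans (derive1_le_increment R (f s) M K (v s) (u s) _ _ _ _ vus) _.
  - by move=> x; exact: f_derivable.
  - by move=> x; exact: f_omega_le_K.
  - exact: v_le_M.
  - exact: u_le_M.
  by apply: ler_wpM2l => //; apply: w_le_b; case/andP: sT => -> _; case/andP: sb.
(* In this form the convolution splits into two explicit powers and the fractional integrals of u
   and v. *)
pose P s := step R a (w b) s + step R 0 (- w 0) s - (w s - w 0).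
have PE s : 0 <= s -> P s = (if a <= s then w b else 0) - w s.
  by move=> s0; rewrite /P /step s0; case: ifP => _;
    move: (w b) (w 0) (w s) => x y z; ring.
have wM s : 0 <= s <= b -> `|w s| <= M + M.
  case/andP => s0 sb; apply: le_trans (ler_normB _ _) _.
  have sT : 0 <= s <= T by rewrite s0 (le_trans sb).
  by apply: lerD; [exact: u_le_M|exact: v_le_M].
have mw : measurable_fun `[0, b] w.
  apply: subspace_continuous_measurable_fun => //.
  apply: continuous_subspaceW cw => s /=; rewrite !in_itv/= => /andP[-> sb].
  exact: le_trans bT.
have conv_sol (y : R -> R) (t : R) : {within `[0, T], continuous y} ->
    (forall s, 0 <= s <= T -> `|y s| <= M) -> 0 <= t <= b ->
    lebesgue_measure.-integrable `[0, b]
      (EFin \o (fun s => abel_kernel R alpha (t - s) * (y s - y 0))) /\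
    abel_conv R alpha b (fun s => y s - y 0) t = c * F y t.
  move=> cy yM tb; split; last first.
    case/andP: tb => _ tb.
    by rewrite FE (frac_integralE R alpha alpha01 _ t b tb) mulVKf// gt_eqF.
  apply: (integrable_abel_kernelM R alpha alpha01 _ (M + M)) => //.
    apply: measurable_funB => //; apply: subspace_continuous_measurable_fun => //.
    apply: continuous_subspaceW cy => s /=; rewrite !in_itv/= => /andP[-> sb].
    exact: le_trans bT.
  move=> s /andP[s0 sb]; apply: le_trans (ler_normB _ _) _.
  by apply: lerD; apply: yM; rewrite ?s0 ?(le_trans sb).
have int_step x (y t : R) : 0 <= t <= b ->
    lebesgue_measure.-integrable `[0, b]
      (EFin \o (fun s => abel_kernel R alpha (t - s) * step R x y s)).
  move=> tb; apply: (integrable_abel_kernelM R alpha alpha01 _ `|y|) => //.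
    by apply: measurable_funTS; exact: measurable_step.
  by move=> s _; exact: step_bounded.
have convP t : a <= t <= b -> abel_conv R alpha b P t =
    w b * ((t - a) `^ (1 - alpha) / (1 - alpha)) +
    (- w 0) * (t `^ (1 - alpha) / (1 - alpha)) - c * (F u t - F v t).
  move=> atb; have [a_t tb] := andP atb; have t0b : 0 <= t <= b by rewrite (le_trans a0).
  have [iu cuE] := conv_sol u t cu u_le_M t0b.
  have [iv cvE] := conv_sol v t cv v_le_M t0b.
  have ia := int_step a (w b) t t0b; have i0 := int_step 0 (- w 0) t t0b.
  have := abel_conv_step R alpha alpha01 a b (w b) t a0 atb.
  have := abel_conv_step R alpha alpha01 0 b (- w 0) t (lexx _) t0b.
  rewrite subr0 => <- <-; rewrite mulrBr -cuE -cvE /abel_conv.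
  rewrite -RintegralD// -RintegralB// -RintegralB//; last 2 first.
  - by have := integrableD _ ia i0; exact.
  - by have := integrableB _ iu iv; exact.
  by apply: eq_Rintegral => s _; rewrite /P /w; ring.
(* The slope delta = w b is what remains of w b (c K + 1) from the jump minus c K w b from the
   solutions; the constant - w 0 >= 0 only adds to it. *)
have [] := abel_conv_touch R alpha alpha01 P b (w b + (M + M)) eta (w b) eta_b wb.
- apply: measurable_funB; last exact: measurable_funB.
  by apply: measurable_funD; apply: measurable_funTS; exact: measurable_step.
- move=> s s0b; have /andP[s0 sb] := s0b; rewrite PE//.
  have := wM s s0b; rewrite ler_norml => /andP[? ?].
  case: ifPn => [as_|]; first by have := w_le_b s s0b; lra.
  rewrite -ltNge => sa; have : w s <= 0 by apply: w_le_a; rewrite s0 ltW.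
  lra.
- move=> t t' et' t't tb.
  have at' : a <= t' := le_trans eta_a et'.
  have t'0 := le_trans a0 at'.
  have [->|tt'] := eqVneq t t'; first by rewrite !subrr mulr0.
  have t't_lt : t' < t by rewrite lt_neqAle eq_sym tt'.
  rewrite !convP ?at' ?(le_trans at' t't) ?tb ?(le_trans t't)//.
  have ta : 0 < t - a by rewrite subr_gt0 (le_lt_trans at').
  have t'a : 0 <= t' - a by rewrite subr_ge0.
  have tangent x y : 0 < x -> 0 <= y ->
      x `^ (- alpha) * (x - y) <= (x `^ (1 - alpha) - y `^ (1 - alpha)) / (1 - alpha).
    by move=> x0 y0; rewrite ler_pdivlMr// mulrC mulrA powR_concave_tangent.
  have t_tau : (c * K + 1) * (t - t') <= (t - a) `^ (- alpha) * (t - a - (t' - a)).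
    rewrite (_ : t - a - (t' - a) = t - t'); last by ring.
    rewrite ler_wpM2r ?subr_ge0// -tauE; apply: powRN_ni => //.
    by rewrite lerBlDl (le_trans tb)// ltW.
  have := ler_wpM2l (ltW wb) (le_trans t_tau (tangent _ _ ta t'a)).
  have D2 : 0 <= (t `^ (1 - alpha) - t' `^ (1 - alpha)) / (1 - alpha).
    apply: le_trans (tangent _ _ (le_lt_trans t'0 t't_lt) t'0).
    by rewrite mulr_ge0 ?powR_ge0 ?subr_ge0.
  have w0' : 0 <= - w 0 by rewrite oppr_ge0.
  have := mulr_ge0 w0' D2.
  have := ler_wpM2l (ltW c0) (incr t t' et' t't tb).
  move: (F u t - F v t) (F u t' - F v t') (w b) (w 0) => Ft Ft' wb0 w00.
  move: ((t - a) `^ _) ((t' - a) `^ _) (t `^ _) (t' `^ _) (1 - alpha)^-1.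
  by clear=> *; lra.
move=> e e0 /=.
(* For s in [a, b] close to b, continuity gives P s = w b - w s < e, against the lower bound e just
   obtained. *)
have [d' d'0 d'P] := within_continuous_dist R w 0 T b e cw bT' e0.
pose h := Num.min eta (d' / 2).
have h0 : 0 < h by rewrite lt_min eta0 divr_gt0.
have h_eta : h <= eta by rewrite ge_min lexx.
have h_d : h <= d' / 2 by rewrite ge_min lexx orbT.
move=> /(_ h); rewrite h0 h_eta => /(_ isT)[s /andP[hs sb]].
have as_ : a <= s by lra.
have s0 : 0 <= s := le_trans a0 as_.
have sT : 0 <= s <= T by rewrite s0 (le_trans sb).
have sd : `|s - b| < d' by rewrite ltr_norml; apply/andP; split; lra.
have := d'P s sT sd; rewrite PE// as_ ltr_norml => /andP[? ?]; lra.
Qed.
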